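(* If $X$ is a compact metric space containing an open $n$-cell for some $n\ge 2$, then $H(X)$ does not have a minimum Hausdorff group topology.
   Context: $H(X)$ denotes the group of all homeomorphisms of $X$ onto itself under composition. A topology on a group is a group topology if the group operations are continuous for it. A minimum Hausdorff group topology on a group $G$ is a Hausdorff group topology on $G$ contained in every Hausdorff group topology on $G$. An open $n$-cell in $X$ is an open subset of $X$ homeomorphic to $\mathbb{R}^n$. *)

(* Defs.v *)
From HB Require Import structures.
From mathcomp Require Import all_boot all_order all_algebra.
From mathcomp Require Import all_classical all_reals all_analysis.

Set Implicit Arguments.
Unset Strict Implicit.
Unset Printing Implicit Defensive.

Import numFieldNormedType.Exports.

Local Open Scope classical_set_scope.

Definition homeomorphism (S T : topologicalType) (f : S -> T) : Prop :=
  continuous f /\ exists g : T -> S, [/\ continuous g, cancel f g & cancel g f].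

Definition homeomorphic (S T : topologicalType) : Prop :=
  exists f : S -> T, homeomorphism f.

Lemma homeomorphism_id (X : topologicalType) : homeomorphism (@id X).
Proof. by split; [|exists id; split]; move=> x //; exact: cvg_id. Qed.

Lemma homeomorphism_comp (X Y Z : topologicalType) (f : Y -> Z) (g : X -> Y) :
  homeomorphism f -> homeomorphism g -> homeomorphism (f \o g).
Proof.
move=> [cf [f' [cf' fK f'K]]] [cg [g' [cg' gK g'K]]]; split.
  by move=> x; apply: continuous_comp; [exact: cg|exact: cf].
exists (g' \o f'); split; [|exact: can_comp|exact: can_comp].
by move=> x; apply: continuous_comp; [exact: cf'|exact: cg'].
Qed.

Record homeo (X : topologicalType) := Homeo {
  homeo_fun :> X -> X;
  homeoP : homeomorphism homeo_fun }.

Section HomeoGroup.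
Variable X : topologicalType.
Implicit Types f g h : homeo X.

HB.instance Definition _ := gen_eqMixin (homeo X).
HB.instance Definition _ := gen_choiceMixin (homeo X).

Lemma homeo_eq f g : homeo_fun f =1 homeo_fun g -> f = g.
Proof.
case: f g => f fP [g gP] /= /funext fg.
by case: _ / fg gP => gP; congr Homeo; exact: Prop_irrelevance.
Qed.

Definition homeo_one : homeo X := Homeo (homeomorphism_id X).

Definition homeo_mul f g : homeo X :=
  Homeo (homeomorphism_comp (homeoP f) (homeoP g)).

Lemma homeo_inv_subproof f : exists g : homeo X, cancel f g /\ cancel g f.
Proof.
case: f => f [cf [g [cg fK gK]]].
have gP : homeomorphism g by split=> //; exists f.
by exists (Homeo gP).
Qed.

Definition homeo_inv f : homeo X := sval (cid (homeo_inv_subproof f)).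

Lemma homeo_invP f : cancel f (homeo_inv f) /\ cancel (homeo_inv f) f.
Proof. exact: (svalP (cid (homeo_inv_subproof f))). Qed.

Lemma homeo_mulA : associative homeo_mul.
Proof. by move=> f g h; apply: homeo_eq. Qed.

Lemma homeo_mul1 : left_id homeo_one homeo_mul.
Proof. by move=> f; apply: homeo_eq. Qed.

Lemma homeo_mul1r : right_id homeo_one homeo_mul.
Proof. by move=> f; apply: homeo_eq. Qed.

Lemma homeo_mulV : left_inverse homeo_one homeo_inv homeo_mul.
Proof. by move=> f; apply: homeo_eq => x; exact: (homeo_invP f).1. Qed.

Lemma homeo_mulrV : right_inverse homeo_one homeo_inv homeo_mul.
Proof. by move=> f; apply: homeo_eq => x; exact: (homeo_invP f).2. Qed.

HB.instance Definition _ := isGroup.Build (homeo X)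
  homeo_mulA homeo_mul1 homeo_mul1r homeo_mulV homeo_mulrV.

End HomeoGroup.

(* Topologies as values, so that several of them on one carrier can be compared;
   [topologized t] is the carrier of [t] seen as a [topologicalType]. *)

Record topology (T : Type) := Topology {
  opens : set_system T;
  opens_setT : opens setT;
  opens_setI : setI_closed opens;
  opens_bigcup : forall F : set_system T,
    F `<=` opens -> opens (\bigcup_(A in F) A) }.

Definition topologized (T : Type) (t : topology T) : Type := T.

Section Topologized.
Variables (T : choiceType) (t : topology T).

Lemma opens_bigU (I : Type) (f : I -> set T) :
  (forall i, opens t (f i)) -> opens t (\bigcup_i f i).
Proof.
move=> fop; have -> : \bigcup_i f i = \bigcup_(A in range f) A.
  by rewrite bigcup_image.
by apply: opens_bigcup => _ [i _ <-].
Qed.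

HB.instance Definition _ := Choice.on (topologized t).
HB.instance Definition _ := isOpenTopological.Build (topologized t)
  (opens_setT t) (@opens_setI _ t) opens_bigU.

End Topologized.

Definition group_topology (G : groupType) (t : topology G) : Prop :=
  let Gt := topologized t in
  continuous ((fun p => (p.1 * p.2)%g) : Gt * Gt -> Gt) /\
  continuous ((fun x => (x^-1)%g) : Gt -> Gt).

Definition hausdorff_group_topology (G : groupType) (t : topology G) : Prop :=
  hausdorff_space (topologized t) /\ group_topology t.

Definition minimum_hausdorff_group_topology (G : groupType) (t : topology G) :
    Prop :=
  hausdorff_group_topology t /\
  forall s : topology G, hausdorff_group_topology s -> opens t `<=` opens s.

(* [set_type U] carries the subspace topology, and ['rV[R]_n] that of R^n. *)
Definition open_cell (R : realType) (X : topologicalType) (n : nat)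
    (U : set X) : Prop :=
  open U /\ homeomorphic (set_type U) 'rV[R]_n.

(* Main.v *)
Require Import Defs.
From mathcomp Require Import all_boot all_order all_algebra.
From mathcomp Require Import all_classical all_reals all_analysis.
From mathcomp Require Import ring lra.

(** A minimum Hausdorff group topology T on H(X) would be contained in two
    particular ones: that of uniform convergence, and that of pointwise
    convergence for the discrete topology on X, where the stabilizers of finite
    sets are a basis at the identity.  A single h <> 1 is exhibited that lies in
    every T-neighbourhood A of 1, contradicting that T is Hausdorff.

    Take a T-neighbourhood W of 1 with W W W W inside A.  It contains the
    pointwise stabilizer of a finite set F and all homeomorphisms that are
    uniformly close to the identity.  It is enough to write h = s1 s2 where s1
    fixes F pointwise and s2 fixes tau^-1(F) pointwise, with tau uniformly close
    to the identity: then tau s2 tau^-1 fixes F as well and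
      h = s1 . tau^-1 . (tau s2 tau^-1) . tau
    is a product of four elements of W ([push_factorization]).

    In the chart R^n of the open cell, h pushes the points of the cube ]-1, 1[^n
    along coordinate i with a strength depending only on the other coordinates,
    and it is the identity outside the cube.  Multiplying the strength by any
    function with values in [0, 1] of another coordinate j, which exists because
    n >= 2, yields such a push again.  Take for tau a weak push along j.  If its
    strength is small and non-zero, no j-coordinate of a point of tau^-1(F) in
    the cube is the j-coordinate of a point of F in the cube
    ([push_off_finite]), so some continuous function l of coordinate j is 0 on
    the latter and 1 on the former.  The push s1 with strength multiplied by l
    is the identity on F and coincides with h on tau^-1(F), hence s2 = s1^-1 h
    is the identity on tau^-1(F). *)

Set Implicit Arguments.
Unset Strict Implicit.
Unset Printing Implicit Defensive.

Import Order.TTheory GRing.Theory Num.Theory.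
Import numFieldNormedType.Exports.

Local Open Scope classical_set_scope.

(** * Group topologies from filters at the identity *)

Section IdentityFilter.
Variables (G : groupType) (N : set_system G).

(** The axioms satisfied by the neighbourhoods of 1 in a topological group. *)
Record identity_filter : Prop := IdentityFilter {
  identity_filter_filter : Filter N;
  identity_filter1 : forall V, N V -> V 1%g;
  identity_filterV : forall V, N V -> N [set x | V (x^-1)%g];
  identity_filterM : forall V, N V ->
    exists2 W, N W & forall x y, W x -> W y -> V (x * y)%g;
  identity_filterJ : forall g V, N V -> N [set x | V (g * x * g^-1)%g] }.

Hypothesis idN : identity_filter.

Let N_filter : Filter N := identity_filter_filter idN.
#[local] Existing Instance N_filter.

(** The left translates of [N] serve as neighbourhood filters. *)
Definition filter_opens : set_system G :=
  [set A | forall g, A g -> N [set x | A (g * x)%g]].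

Let filter_opensT : filter_opens setT.
Proof. by move=> g _; exact: filterT. Qed.

Let filter_opensI : setI_closed filter_opens.
Proof.
by move=> A B oA oB g [Ag Bg]; apply: filterI; [exact: oA|exact: oB].
Qed.

Let filter_opens_bigcup (F : set_system G) :
  F `<=` filter_opens -> filter_opens (\bigcup_(A in F) A).
Proof.
move=> Fo g [A FA Ag]; apply: filterS (Fo A FA g Ag) => x Agx.
by exists A.
Qed.

Definition filter_topology : topology G :=
  Topology filter_opensT filter_opensI filter_opens_bigcup.

(** The points of which [V] is a neighbourhood form an open set, because [N] has
    W W inside V. *)
Lemma nbhs_filter_topology (g : topologized filter_topology) (V : set G) :
  nbhs g V <-> N [set x | V ((g : G) * x)%g].
Proof.
split=> [[B [oB Bg BV]]|NV]; first by apply: filterS (oB _ Bg) => x /BV.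
exists [set h : G | N [set x | V (h * x)%g]]; split=> //; last first.
  by move=> h /= /(identity_filter1 idN) /=; rewrite mulg1.
move=> h /= /(identity_filterM idN)[W NW WV]; apply: filterS (NW) => w Ww.
by apply: filterS (NW) => x Wx; have := WV _ _ Ww Wx; rewrite /= mulgA.
Qed.

Lemma filter_topology_group : group_topology filter_topology.
Proof.
split.
- move=> [g h] A /= /nbhs_filter_topology /(identity_filterM idN)[W NW WA].
  (* (g u) (h w) = g h (h^-1 u h) w, so u has to be small up to conjugation *)
  exists ([set x | W (h^-1 * (g^-1 * x) * h)%g], [set x | W (h^-1 * x)%g]).
    split; apply/nbhs_filter_topology => /=.
      have := identity_filterJ idN (h^-1)%g NW; apply: filterS => x /=.
      by rewrite invgK mulKg.
    by apply: filterS NW => x Wx /=; rewrite mulKg.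
  move=> [x y] /= [Wx Wy]; have := WA _ _ Wx Wy.
  by rewrite /= !mulgA !mulgK (@mulgV G) (@mul1g G).
- move=> g A /= /nbhs_filter_topology NA; apply/nbhs_filter_topology.
  have := identity_filterJ idN g (identity_filterV idN NA).
  by apply: filterS => x /=; rewrite !invgM !invgK !mulgA (@mulVg G) (@mul1g G).
Qed.

Lemma filter_topology_hausdorff :
  (forall x, x != 1%g -> exists2 V, N V & ~ V x) ->
  hausdorff_group_topology filter_topology.
Proof.
move=> sepN; split; last exact: filter_topology_group.
move=> g h cgh; apply: contrapT => /eqP gh.
have : (g^-1 * h)%g != 1%g :> G.
  by apply: contra_neq gh => e; rewrite -(mulg1 (g : G)) -e mulVKg.
move=> /sepN[V NV nV]; have [W NW WV] := identity_filterM idN NV.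
(* g W and h W^-1 are disjoint because W W does not contain g^-1 h *)
have [] := cgh [set x | W (g^-1 * x)%g] [set x | W (h^-1 * x)^-1%g].
- by apply/nbhs_filter_topology; apply: filterS NW => x Wx /=; rewrite mulKg.
- apply/nbhs_filter_topology; have := identity_filterV idN NW.
  by apply: filterS => x Wx /=; rewrite mulKg.
- move=> x [/= Wg Wh]; apply: nV; have := WV _ _ Wg Wh.
  by rewrite invgM invgK mulgA mulgK.
Qed.

Lemma nbhs1_filter_topology (V : set G) :
  nbhs (1%g : topologized filter_topology) V -> N V.
Proof. by move/nbhs_filter_topology; apply: filterS => x /=; rewrite mul1g. Qed.

End IdentityFilter.

Lemma group_topology_mul4 (G : groupType) (t : topology G) (A : set G) :
  group_topology t -> opens t A -> A 1%g ->
  exists2 W, opens t W & W 1%g /\ forall x y z w, W x -> W y -> W z -> W w ->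
    A (x * y * (z * w))%g.
Proof.
move=> [cM _].
have half (B : set G) : opens t B -> B 1%g -> exists2 W, opens t W &
    W 1%g /\ forall x y, W x -> W y -> B (x * y)%g.
  move=> oB B1; have : nbhs ((1 * 1)%g : topologized t) B.
    by exists B; split; rewrite ?mulg1.
  move=> /(cM (1%g, 1%g))[] [P Q] /= [[P' [oP P1 PP]] [Q' [oQ Q1 QQ]]] PQ.
  exists (P' `&` Q'); first exact: opens_setI.
  split=> // x y [Px _] [_ Qy].
  by apply: (PQ (x, y)); split; [exact: PP|exact: QQ].
move=> oA A1; have [W oW [W1 WA]] := half A oA A1.
have [W' oW' [W'1 W'W]] := half W oW W1.
exists W' => //; split=> // x y z w Wx Wy Wz Ww.
by apply: WA; exact: W'W.
Qed.

(** * Two Hausdorff group topologies on a homeomorphism group *)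

(** Heine-Cantor. *)
Lemma compact_unif_continuous (X Y : uniformType) (f : X -> Y) :
  compact [set: X] -> continuous f -> unif_continuous f.
Proof.
move=> cX cf E eE; pose H := split_ent E.
have eH : entourage H by exact: entourage_split_ent.
(* compactness, indexed by shrinking relations D, yields one D for all x *)
pose small := filter_from (@entourage X) (fun D => [set D' | D' `<=` D]).
have small_filter : Filter small.
  apply: filter_from_filter; first by exists setT; exact: filterT.
  move=> D D' eD eD'; exists (D `&` D'); first exact: filterI.
  by move=> C; rewrite /= subsetI.
pose P (D : set (X * X)) x := forall y, D (x, y) -> E (f x, f y).
have [|D eD DP] := (compact_near_coveringP _).1 cX _ small P small_filter.
  move=> x _.
  have : nbhs x (f @^-1` (xsection H (f x) `&` xsection (H^-1)%relation (f x))).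
    apply: cf; apply: filterI; first exact: (nbhs_entourage (f x) eH).
    exact: (nbhs_entourage (f x) (entourage_inv eH)).
  rewrite -nbhs_entourageE => -[D eD DH].
  exists (xsection (split_ent D) x, [set D' | D' `<=` split_ent D]).
    split; last by exists (split_ent D) => //; exact: entourage_split_ent.
    by apply: nbhs_entourage; exact: entourage_split_ent.
  move=> [x' D'] [/= /xsectionP xx' D'D] y /D'D x'y.
  have /DH[_ /xsectionP Hx'x] : xsection D x x'.
    apply/xsectionP; apply: (entourage_split x') => //.
    exact: entourage_refl (entourage_split_ent eD).
  have /DH[/xsectionP Hxy _] : xsection D x y.
    by apply/xsectionP; exact: (entourage_split x').
  exact: (entourage_split (f x)).
by apply: filterS eD => -[x y] /= Dxy; exact: (DP D).
Qed.

Definition uniform_filter (X : uniformType) : set_system (homeo X) :=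
  filter_from entourage (fun E => [set f : homeo X | forall x, E (x, f x)]).

Definition pointwise_filter (X : topologicalType) : set_system (homeo X) :=
  filter_from finite_set
    (fun F => [set f : homeo X | forall x, F x -> f x = x]).

Lemma pointwise_identity_filter (X : topologicalType) :
  identity_filter (@pointwise_filter X).
Proof.
split.
- apply: filter_from_filter; first by exists set0.
  move=> F F' fF fF'; exists (F `|` F'); first by rewrite finite_setU.
  by move=> f fP; split=> x Fx; apply: fP; [left|right].
- by move=> V [F _ FV]; apply: FV.
- move=> V [F fF FV]; exists F => // f fP; apply: FV => x Fx.
  by rewrite -{1}(fP x Fx); exact: (homeo_invP f).1.
- move=> V [F fF FV]; exists [set f : homeo X | forall x, F x -> f x = x].
    by exists F.
  by move=> f g fP gP; apply: FV => x Fx /=; rewrite gP// fP.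
- move=> g V [F fF FV]; exists (homeo_inv g @` F); first exact: finite_image.
  move=> f fP; apply: FV => x Fx /=.
  by rewrite fP; [exact: (homeo_invP g).2|exists x].
Qed.

(** Compactness of [X] gives stability under conjugation: g f g^-1 is close to
    the identity as soon as f is, because g is uniformly continuous. *)
Lemma uniform_identity_filter (X : uniformType) :
  compact [set: X] -> identity_filter (@uniform_filter X).
Proof.
move=> cX; split.
- apply: filter_from_filter; first by exists setT; exact: filterT.
  move=> E E' eE eE'; exists (E `&` E'); first exact: filterI.
  by move=> f fP; split=> x; have [] := fP x.
- by move=> V [E eE EV]; apply: EV => x; exact: entourage_refl.
- move=> V [E eE EV]; exists (E^-1)%relation; first exact: entourage_inv.
  move=> f fP; apply: EV => x; have := fP (homeo_inv f x).
  by rewrite /= (homeo_invP f).2.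
- move=> V [E eE EV].
  exists [set f : homeo X | forall x, split_ent E (x, f x)].
    by exists (split_ent E) => //; exact: entourage_split_ent.
  move=> f g fP gP; apply: EV => x /=.
  exact: (entourage_split (g x)).
- move=> g V [E eE EV].
  have cg : continuous g by have [] := homeoP g.
  have := compact_unif_continuous cX cg eE => eE'.
  eexists; first exact: eE'.
  move=> f fP; apply: EV => x; have := fP (homeo_inv g x).
  by rewrite /= (homeo_invP g).2.
Qed.

Lemma homeo_neq1 (X : topologicalType) (f : homeo X) :
  f != 1%g -> exists x, f x <> x.
Proof.
move=> /eqP f1; apply: contrapT => fx; apply: f1; apply: homeo_eq => x.
by apply: contrapT => fxx; apply: fx; exists x.
Qed.

Lemma uniform_hausdorff_topology (X : uniformType) (cX : compact [set: X]) :
  hausdorff_space X ->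
  hausdorff_group_topology (filter_topology (uniform_identity_filter cX)).
Proof.
move=> hX; apply: filter_topology_hausdorff => f /homeo_neq1[x fx].
have : ~ close x (f x) by move/(close_eq hX)/esym.
rewrite entourage_close => /existsNP[E /not_implyP[eE nE]].
by exists [set g : homeo X | forall y, E (y, g y)]; [exists E|move/(_ x)].
Qed.

Lemma pointwise_hausdorff_topology (X : topologicalType) :
  hausdorff_group_topology (filter_topology (pointwise_identity_filter X)).
Proof.
apply: filter_topology_hausdorff => f /homeo_neq1[x fx].
exists [set g : homeo X | forall y, [set x] y -> g y = y].
  by exists [set x] => //; exact: finite_set1.
by move/(_ x erefl).
Qed.

(** * Pushing along one coordinate of R^n *)

Section PushInterval.
Local Open Scope ring_scope.
Variable R : realType.
Implicit Types a y : R.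

(** Projection of the line onto the interval [-1, 1]. *)
Definition clamp y : R := (`|y + 1| - `|y - 1|) / 2.

Lemma clamp_in y : `|y| < 1 -> clamp y = y.
Proof.
rewrite ltr_norml => /andP[? ?]; rewrite /clamp ger0_norm ?ler0_norm; lra.
Qed.

Lemma clamp_out y : 1 <= `|y| -> clamp y ^+ 2 = 1.
Proof.
rewrite ler_normr => /orP[] ?; rewrite /clamp.
  by rewrite !ger0_norm; [field|lra|lra].
by rewrite !ler0_norm; [field|lra|lra].
Qed.

Lemma clamp_sqr_le1 y : clamp y ^+ 2 <= 1.
Proof.
have [y1|y1] := ltP `|y| 1; last by rewrite clamp_out.
by rewrite clamp_in// -real_normK ?num_real// expr_le1// ltW.
Qed.

Lemma clamp_norm_le1 y : `|clamp y| <= 1.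
Proof. by rewrite -(@expr_le1 _ 2)// real_normK ?num_real// clamp_sqr_le1. Qed.

Lemma clamp_continuous : continuous clamp.
Proof.
move=> y; apply: cvgM; last exact: cvg_cst.
apply: cvgB; apply: cvg_norm; [apply: cvgD|apply: cvgB] => //;
  exact: cvg_cst.
Qed.

(** The projective transformation y |-> (y + a) / (1 + a y) of [-1, 1], which
    fixes both ends, extended by the identity ([push1_in], [push1_out]).
    Clamping gives one formula for both cases, which makes joint continuity in
    [a] and [y] immediate; the inverse is the transformation for [- a]. *)
Definition push1 a y : R := y + a * (1 - clamp y ^+ 2) / (1 + a * clamp y).

Lemma push1_0 y : push1 0 y = y.
Proof. by rewrite /push1 !mul0r addr0. Qed.

Lemma push1_out a y : 1 <= `|y| -> push1 a y = y.
Proof. by move=> y1; rewrite /push1 clamp_out// subrr mulr0 mul0r addr0. Qed.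

Lemma push1_denom_gt0 a c : `|a| < 1 -> `|c| <= 1 -> 0 < 1 + a * c.
Proof.
rewrite ltr_norml ler_norml => /andP[? ?] /andP[? ?].
have [c0|c0] := ltP c 0; nra.
Qed.

Lemma push1_in a y : `|a| < 1 -> `|y| < 1 -> push1 a y = (y + a) / (1 + a * y).
Proof.
move=> a1 y1; rewrite /push1 clamp_in//.
have /lt0r_neq0 := push1_denom_gt0 a1 (ltW y1).
by move=> d0; field.
Qed.

Lemma push1_in_lt1 a y : `|a| < 1 -> `|y| < 1 -> `|push1 a y| < 1.
Proof.
move=> a1 y1; rewrite push1_in//; have d0 := push1_denom_gt0 a1 (ltW y1).
rewrite normrM normfV [X in _ / X]gtr0_norm// ltr_pdivrMr// mul1r.
move: a1 y1; rewrite !ltr_norml => /andP[? ?] /andP[? ?].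
apply/andP; split; nra.
Qed.

Lemma push1K a : `|a| < 1 -> cancel (push1 a) (push1 (- a)).
Proof.
move=> a1 y; have [y1|y1] := ltP `|y| 1; last by rewrite !push1_out.
rewrite push1_in ?normrN ?push1_in_lt1// push1_in//.
have d0 := push1_denom_gt0 a1 (ltW y1).
have : 0 < 1 - a ^+ 2.
  by rewrite subr_gt0 -real_normK ?num_real// expr_lt1.
move=> /lt0r_neq0 e0; field; rewrite lt0r_neq0//=.
by apply: contra_neq e0 => <-; ring.
Qed.

Lemma push1_moves a y : `|a| < 1 -> a != 0 -> `|y| < 1 -> push1 a y != y.
Proof.
move=> a1 a0 y1; rewrite /push1 clamp_in// -subr_eq0 addrAC subrr add0r.
have /lt0r_neq0 d0 := push1_denom_gt0 a1 (ltW y1).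
rewrite !mulf_neq0// ?invr_neq0//.
by rewrite subr_eq0 eq_sym lt_eqF// -real_normK ?num_real// expr_lt1.
Qed.

Lemma cvg_push1 (T : Type) (F : set_system T) (FF : Filter F) (u w : T -> R)
    (a y : R) : `|a| < 1 -> u @ F --> a -> w @ F --> y ->
  (fun t => push1 (u t) (w t)) @ F --> push1 a y.
Proof.
move=> a1 ua wy.
have cwy : (fun t => clamp (w t)) @ F --> clamp y.
  by apply: continuous_cvg => //; exact: clamp_continuous.
apply: cvgD => //; apply: cvgM.
  apply: cvgM => //; apply: cvgB; first exact: cvg_cst.
  by rewrite expr2; apply: cvgM.
apply: cvgV; last by apply: cvgD; [exact: cvg_cst|exact: cvgM].
by rewrite lt0r_neq0// push1_denom_gt0// clamp_norm_le1.
Qed.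

End PushInterval.

Section Push.
Local Open Scope ring_scope.
Variables (R : realType) (n : nat).
Implicit Types (i j : 'I_n) (v w : 'rV[R]_n) (c : 'rV[R]_n -> R).

Definition cube : set 'rV[R]_n := [set v | forall j, `|v 0 j| < 1].

Definition closed_cube : set 'rV[R]_n := [set v | forall j, v 0 j \in `[-1, 1]].

Lemma closed_cube_compact : compact closed_cube.
Proof.
apply: (@rV_compact R n (fun=> [set` `[-1, 1]])) => j.
exact: segment_compact.
Qed.

Lemma cube_sub_closed_cube : cube `<=` closed_cube.
Proof.
by move=> v vC j; rewrite in_itv /= -ler_norml ltW.
Qed.

(** A strength that ignores coordinate [i] is not altered by a push along [i];
    this makes such a push invertible. *)
Definition transverse i c : Prop :=
  forall v w, (forall j, j != i -> v 0 j = w 0 j) -> c v = c w.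

(** Positive inside the cube, and 0 as soon as a coordinate other than [i] is
    out of range. *)
Definition taper i v : R := \prod_(j < n | j != i) (1 - clamp (v 0 j) ^+ 2).

Lemma taper_transverse i : transverse i (taper i).
Proof. by move=> v w vw; apply: eq_bigr => j ji; rewrite vw. Qed.

Lemma taper_norm_le1 i v : `|taper i v| <= 1.
Proof.
rewrite normr_prod; apply: prodr_ile1 => j _.
rewrite normr_ge0 /= ger0_norm ?subr_ge0 ?clamp_sqr_le1//.
by rewrite lerBlDr lerDl sqr_ge0.
Qed.

Lemma taper_neq0 i v : cube v -> taper i v != 0.
Proof.
move=> vC; apply/prodf_neq0 => j _; rewrite clamp_in// subr_eq0 eq_sym.
by rewrite lt_eqF// -real_normK ?num_real// expr_lt1.
Qed.

Lemma taper_out i j v : j != i -> 1 <= `|v 0 j| -> taper i v = 0.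
Proof. by move=> ji vj; rewrite /taper (bigD1 j)//= clamp_out// subrr mul0r. Qed.

Lemma taper_continuous i : continuous (taper i).
Proof.
apply: (@continuous_big _ _ _ _ _ (@mul_continuous R)) => j _ v.
apply: (@cvgB _ _ _ (nbhs v)); first exact: cvg_cst.
have cj : (fun v : 'rV[R]_n => clamp (v 0 j)) @ v --> clamp (v 0 j).
  apply: (@continuous_cvg _ _ _ (nbhs v) _ _ (@clamp R)).
    exact: clamp_continuous.
  exact: coord_continuous.
by rewrite expr2; exact: cvgM.
Qed.

(** The factor [taper] lets the strength vanish at the boundary of the cube, so
    that the push matches the identity outside; the strength [c] stays free. *)
Definition push i c v : 'rV[R]_n :=
  v + (push1 (c v * taper i v) (v 0 i) - v 0 i) *: delta_mx 0 i.

Lemma push_same i c v : push i c v 0 i = push1 (c v * taper i v) (v 0 i).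
Proof. by rewrite !mxE !eqxx mulr1 addrC subrK. Qed.

Lemma push_other i c v j : j != i -> push i c v 0 j = v 0 j.
Proof. by move=> /negPf ji; rewrite !mxE ji mulr0 addr0. Qed.

Lemma push_eq0 i c v : c v = 0 -> push i c v = v.
Proof. by move=> c0; rewrite /push c0 mul0r push1_0 subrr scale0r addr0. Qed.

Lemma push_out i c v : ~ cube v -> push i c v = v.
Proof.
move=> /existsNP[j /negP]; rewrite -leNgt => vj; rewrite /push.
suff -> : push1 (c v * taper i v) (v 0 i) = v 0 i.
  by rewrite subrr scale0r addr0.
have [ji|ji] := eqVneq j i; first by rewrite push1_out// -ji.
by rewrite (taper_out ji vj) mulr0 push1_0.
Qed.

Lemma strength_lt1 i c v : `|c v| < 1 -> `|c v * taper i v| < 1.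
Proof.
by move=> c1; rewrite normrM (le_lt_trans _ c1)// ler_piMr// taper_norm_le1.
Qed.

Lemma pushK i c : transverse i c -> (forall v, `|c v| < 1) ->
  cancel (push i c) (push i (fun v => - c v)).
Proof.
move=> ci c1 v; have inv w : (forall j, j != i -> w 0 j = v 0 j) ->
    - c w * taper i w = - (c v * taper i v).
  by move=> wv; rewrite mulNr (ci w v)// (taper_transverse (w := v)).
apply/rowP => j; have [->|ji] := eqVneq j i; last by rewrite !push_other.
rewrite push_same inv; last by move=> k /push_other.
by rewrite push_same push1K// strength_lt1.
Qed.

(** Joint continuity in strength and point; the strength is a number here, and
    is allowed to vary with the filter. *)
Lemma cvg_push (T : Type) (F : set_system T) (FF : Filter F) i
    (s : T -> R) (r : R) (u : T -> 'rV[R]_n) v : `|r| < 1 ->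
  s @ F --> r -> u @ F --> v ->
  (fun t => push i (fun=> s t) (u t)) @ F --> push i (fun=> r) v.
Proof.
move=> r1 sr uv.
have ui : (fun t => u t 0 i) @ F --> v 0 i.
  apply: (@continuous_cvg _ _ _ F FF u (fun w : 'rV[R]_n => w 0 i)) => //.
  exact: coord_continuous.
apply: cvgD => //; apply: cvgZ; last exact: cvg_cst.
apply: cvgB => //; apply: cvg_push1 => //.
  exact: (@strength_lt1 i (fun=> r) v).
apply: cvgM => //; apply: (@continuous_cvg _ _ _ F FF u (taper i)) => //.
exact: taper_continuous.
Qed.

Lemma push_continuous i c : continuous c -> (forall v, `|c v| < 1) ->
  continuous (push i c).
Proof.
move=> cc c1 v; apply: (@cvg_push _ (nbhs v) _ i c (c v) id v) => //.
exact: cc.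
Qed.

End Push.

(** * Transporting homeomorphisms of R^n to an open cell *)

Section Chart.
Local Open Scope ring_scope.
Variables (R : realType) (X : topologicalType) (n : nat) (U : set X).

(** A parametrization [psi] of the open set [U] by R^n and its inverse [phi],
    a total function on [X] whose values outside [U] are arbitrary. *)
Record chart (psi : 'rV[R]_n -> X) (phi : X -> 'rV[R]_n) : Prop := Chart {
  chart_open : open U;
  chart_psi_continuous : continuous psi;
  chart_phi_continuous : forall x, U x -> {for x, continuous phi};
  chart_psiK : cancel psi phi;
  chart_phiK : forall x, U x -> psi (phi x) = x;
  chart_in : forall v, U (psi v) }.

Lemma open_cell_chart : open_cell R n U -> exists psi phi, chart psi phi.
Proof.
move=> [oU [f [cf [g [cg fK gK]]]]].
pose phi x := if pselect (U x) is left Ux then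
  f (exist _ x (mem_set Ux)) else 0.
have phiE (u : set_type U) : phi (set_val u) = f u.
  case: u => x xU; rewrite /phi set_valE /=.
  case: pselect => [Ux|/(_ (set_mem xU))//].
  by rewrite (bool_irrelevance (mem_set Ux) xU).
have valU (u : set_type U) : U (set_val u).
  by rewrite set_valE; exact: set_mem (svalP u).
have Uval x (Ux : U x) : x = set_val (exist _ x (mem_set Ux) : set_type U).
  by rewrite set_valE.
exists (fun v => set_val (g v)), phi; split => //.
- move=> v; apply: continuous_comp; first exact: cg.
  exact: initial_continuous.
- move=> x Ux.
  have : {within U, continuous phi}.
    apply/subspace_sigL_continuousP.
    suff -> : sigL U phi = f by [].
    by apply/funext => u; rewrite -phiE.
  by rewrite continuous_open_subspace// => /(_ x (mem_set Ux)).
- by move=> v; rewrite phiE gK.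
- by move=> x Ux; rewrite [in phi x](Uval x Ux) phiE fK -Uval.
Qed.

End Chart.

Section Extension.
Local Open Scope ring_scope.
Variables (R : realType) (X : topologicalType) (n : nat) (U : set X).
Variables (psi : 'rV[R]_n -> X) (phi : X -> 'rV[R]_n).
Hypotheses (hX : hausdorff_space X) (C : chart U psi phi).
Implicit Types (f g : 'rV[R]_n -> 'rV[R]_n).

Definition extend f (x : X) : X := if x \in U then psi (f (phi x)) else x.

Lemma extend_psi f v : extend f (psi v) = psi (f v).
Proof. by rewrite /extend mem_set ?(chart_psiK C)//; exact: (chart_in C). Qed.

Lemma extend_out f x : ~ U x -> extend f x = x.
Proof. by move=> Ux; rewrite /extend memNset. Qed.

Lemma extendK f g : cancel f g -> cancel (extend f) (extend g).
Proof.
move=> fK x; have [Ux|Ux] := pselect (U x); last by rewrite !extend_out.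
by rewrite -(chart_phiK C Ux) !extend_psi fK.
Qed.

(** [X] is covered by the open sets [U] and the complement of psi(K), on which
    the extension is psi o f o phi and the identity; psi(K) is closed because it
    is compact and [X] is Hausdorff. *)
Lemma extend_continuous f K : compact K -> continuous f ->
  (forall v, ~ K v -> f v = v) -> continuous (extend f).
Proof.
move=> cK cf fK x; have [Ux|Ux] := pselect (U x).
  have near_ext : \forall y \near x, psi (f (phi y)) = extend f y.
    have : nbhs x U by apply: open_nbhs_nbhs; split=> //; exact: (chart_open C).
    by apply: filterS => y Uy; rewrite /extend mem_set.
  rewrite /continuous_at; apply: cvg_trans (near_eq_cvg near_ext) _.
  rewrite /extend mem_set//.
  apply: (@continuous_comp _ _ _ phi (psi \o f)).
    exact: (chart_phi_continuous C).
  apply: continuous_comp; [exact: cf|exact: (chart_psi_continuous C)].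
have near_id : \forall y \near x, y = extend f y.
  have : nbhs x (~` (psi @` K)).
    apply: open_nbhs_nbhs; split; last first.
      by move=> [v _ vx]; apply: Ux; rewrite -vx; exact: (chart_in C).
    rewrite openC; apply: compact_closed => //; apply: continuous_compact => //.
    by apply: continuous_subspaceT; exact: (chart_psi_continuous C).
  apply: filterS => y Ky.
  have [Uy|Uy] := pselect (U y); last by rewrite extend_out.
  rewrite -(chart_phiK C Uy) extend_psi fK// => Kphi; apply: Ky.
  by exists (phi y) => //; exact: (chart_phiK C).
rewrite /continuous_at extend_out//.
by apply: cvg_trans (near_eq_cvg near_id) _; exact: cvg_id.
Qed.

Lemma extend_push_homeo i (c : 'rV[R]_n -> R) :
  continuous c -> transverse i c -> (forall v, `|c v| < 1) ->
  exists h : homeo X,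
    h =1 extend (push i c) /\
    homeo_inv h =1 extend (push i (fun v => - c v)).
Proof.
move=> cc ci c1.
have ext_cont (d : 'rV[R]_n -> R) : continuous d -> (forall v, `|d v| < 1) ->
    continuous (extend (push i d)).
  move=> cd d1; apply: (@extend_continuous _ (@closed_cube R n)).
  - exact: closed_cube_compact.
  - exact: push_continuous.
  - by move=> v vC; apply: push_out => /cube_sub_closed_cube.
have Nc1 v : `|- c v| < 1 by rewrite normrN.
have cNc : continuous (fun v => - c v).
  by move=> v; apply: (@cvgN _ _ _ (nbhs v)); exact: cc.
have Nci : transverse i (fun v => - c v) by move=> v w vw; rewrite (ci v w).
have pK : cancel (push i (fun v => - c v)) (push i c).
  move=> v; have := pushK Nci Nc1 v.
  by under [X in push i X _ = _]eq_fun do rewrite opprK.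
have hP : homeomorphism (extend (push i c)).
  split; first exact: ext_cont.
  exists (extend (push i (fun v => - c v))); split; first exact: ext_cont.
  - exact/extendK/pushK.
  - exact/extendK.
exists (Homeo hP); split=> // x.
apply: (can_inj (homeo_invP (Homeo hP)).1).
by rewrite (homeo_invP (Homeo hP)).2 /= (extendK pK).
Qed.

End Extension.

(** * Factoring a push *)

Lemma filter_forall_finite (T : Type) (I : choiceType) (F : set_system T)
    (A : set I) (P : I -> T -> Prop) : Filter F -> finite_set A ->
  (forall i, A i -> \forall t \near F, P i t) ->
  \forall t \near F, forall i, A i -> P i t.
Proof.
move=> FF /finite_fsetP[D ->] FP.
have := @filter_bigI _ _ D (fun i => [set t | P i t]) _ FF FP.
by apply: filterS => t tP i Di; exact: tP.
Qed.

Section Factorization.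
Local Open Scope ring_scope.
Variables (R : realType) (X : uniformType) (n : nat) (U : set X).
Variables (psi : 'rV[R]_n -> X) (phi : X -> 'rV[R]_n).
Hypotheses (hX : hausdorff_space X) (C : chart U psi phi).

(** At strength 0 the push is the identity; joint continuity in strength and
    point makes the estimate uniform over the compact cube, outside of which
    nothing moves. *)
Lemma push_uniformly_small (i : 'I_n) (E : set (X * X)) : entourage E ->
  \forall d \near (0 : R),
    forall x, E (x, extend U psi phi (push i (fun=> d)) x).
Proof.
move=> eE; pose H := split_ent E.
have eH : entourage H by exact: entourage_split_ent.
have near_vertical (v : 'rV[R]_n) :
    nbhs (v, 0 : R) [set z | E (psi z.1, psi (push i (fun=> z.2) z.1))].
  have cpush : (fun z : 'rV[R]_n * R => push i (fun=> z.2) z.1) @ (v, 0 : R)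
      --> v.
    rewrite -[X in _ --> X](@push_eq0 _ _ i (fun=> 0) v)//.
    by apply: cvg_push; [rewrite normr0|exact: cvg_snd|exact: cvg_fst].
  have c1 : (fun z : 'rV[R]_n * R => psi z.1) @ (v, 0 : R) --> psi v.
    apply: (@continuous_cvg _ _ _ (nbhs (v, 0 : R)) _ fst psi).
      exact: (chart_psi_continuous C).
    exact: cvg_fst.
  have c2 : (fun z : 'rV[R]_n * R => psi (push i (fun=> z.2) z.1)) @ (v, 0 : R)
      --> psi v.
    apply: (@continuous_cvg _ _ _ (nbhs (v, 0 : R)) _
      (fun z => push i (fun=> z.2) z.1) psi).
      exact: (chart_psi_continuous C).
    exact: cpush.
  have n1 : nbhs (v, 0 : R) _ :=
    c1 _ (nbhs_entourage (psi v) (entourage_inv eH)).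
  have n2 : nbhs (v, 0 : R) _ := c2 _ (nbhs_entourage (psi v) eH).
  have := @filterI _ _ (nbhs_filter (v, 0 : R)) _ _ n1 n2.
  apply: filterS => z [/= /xsectionP H1 /xsectionP H2].
  exact: (entourage_split (psi v)).
have [|e e0 eE'] := (compact_near_coveringP _).1 (@closed_cube_compact R n) _
    (nbhs (0 : R)) (fun d v => E (psi v, psi (push i (fun=> d) v))) _.
  by move=> v _; exact: near_vertical.
exists e => // d de x.
have [Ux|Ux] := pselect (U x); last first.
  by rewrite extend_out//; exact: entourage_refl.
rewrite -(chart_phiK C Ux) (extend_psi C).
have [phiC|phiC] := pselect (closed_cube (phi x)); first exact: eE'.
by rewrite push_out; [exact: entourage_refl|move=> /cube_sub_closed_cube].
Qed.

(** For two given points of the cube, coincidence is excluded either because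
    their [i]-coordinates differ and remain different under a weak push, or
    because they agree and any push of non-zero strength separates them. *)
Lemma push_off_finite (i : 'I_n) (S : set 'rV[R]_n) :
  finite_set S -> S `<=` @cube R n ->
  \forall d \near (0 : R)^', forall v, S v -> forall w, S w ->
    push i (fun=> - d) v 0 i != w 0 i.
Proof.
move=> fS SC; apply: filter_forall_finite => // v Sv.
apply: filter_forall_finite => // w Sw.
have b0 : taper i v != 0 by exact/taper_neq0/SC.
have vi : `|v 0 i| < 1 by exact: SC.
have [wv|wv] := eqVneq (w 0 i) (v 0 i).
  near=> d.
  have d0 : d != 0 by near: d; exact: nbhs_dnbhs_neq.
  have d1 : `|d| < 1 by near: d; exact: dnbhs0_lt.
  rewrite push_same wv push1_moves//; last by rewrite mulf_neq0 ?oppr_eq0.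
  by apply: (strength_lt1 i (c := fun=> - d)); rewrite normrN.
apply: nbhs_dnbhs.
have : (fun d : R => push1 (- d * taper i v) (v 0 i)) @ (0 : R)
    --> push1 (- 0 * taper i v) (v 0 i).
  apply: cvg_push1; last exact: cvg_cst.
    by rewrite oppr0 mul0r normr0.
  by apply: cvgM; [apply: cvgN; exact: cvg_id|exact: cvg_cst].
rewrite oppr0 mul0r push1_0 => /(_ [set y | y != w 0 i]) near_v.
have /near_v near_v' : nbhs (v 0 i) [set y | y != w 0 i].
  by apply: open_nbhs_nbhs; split; [exact: open_neq|rewrite /= eq_sym].
apply: (@filterS _ _ (nbhs_filter (0 : R)) _ _ _ near_v') => d.
by rewrite push_same.
Unshelve. all: by end_near. Qed.

(** The homeomorphism [h] does not depend on the finite set [F] nor on the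
    smallness [V] required of [tau], which makes it an element of every
    neighbourhood of the identity for a group topology coarser than both of
    those above. *)
Lemma push_factorization (i j : 'I_n) : i != j ->
  exists2 h : homeo X, h <> homeo_one X &
    forall F V, finite_set F -> uniform_filter V ->
    exists s1 s2 tau : homeo X, [/\ V tau, (forall x, F x -> s1 x = x),
      (forall x, F x -> s2 (homeo_inv tau x) = homeo_inv tau x) &
      h = homeo_mul s1 s2].
Proof.
move=> ij.
have cst_cont (d : R) : continuous (fun _ : 'rV[R]_n => d).
  exact: cst_continuous.
have cst_transverse k (d : R) : transverse k (fun _ : 'rV[R]_n => d) by [].
have half1 : `|2^-1 : R| < 1.
  by rewrite gtr0_norm ?invr_gt0 ?invf_lt1 ?ltr1n ?ltr0n.
have [h [hE _]] := extend_push_homeo hX C (i := i) (c := fun=> 2^-1)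
  (cst_cont _) (cst_transverse _ _) (fun=> half1).
exists h.
  move=> h1; have := hE (psi 0); rewrite h1 /= (extend_psi C).
  move=> /(can_inj (chart_psiK C)) /(congr1 (fun v : 'rV[R]_n => v 0 i)).
  have C0 : cube (0 : 'rV[R]_n) by move=> k; rewrite mxE normr0.
  apply/eqP; rewrite eq_sym push_same push1_moves ?mxE ?normr0//.
    exact: (strength_lt1 i (c := fun=> 2^-1)).
  by rewrite mulf_neq0 ?invr_neq0 ?taper_neq0 ?pnatr_eq0.
move=> F V fF [E eE EV].
pose S := (phi @` (F `&` U)) `&` @cube R n.
have fS : finite_set S.
  by apply: finite_setIl; apply: finite_image; exact: finite_setIl.
(* tau is the push along j of strength d *)
have [d [d1 dE dS]] : exists d : R, [/\ `|d| < 1,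
    (forall x, E (x, extend U psi phi (push j (fun=> d)) x)) &
    (forall v, S v -> forall w, S w -> push j (fun=> - d) v 0 j != w 0 j)].
  near (0 : R)^' => d; exists d; split.
  - by near: d; exact: dnbhs0_lt.
  - by near: d; apply: nbhs_dnbhs; exact: push_uniformly_small.
  - by near: d; apply: push_off_finite => // v [].
have [tau [tauE tauVE]] := extend_push_homeo hX C (i := j) (c := fun=> d)
  (cst_cont _) (cst_transverse _ _) (fun=> d1).
pose P := (fun v : 'rV[R]_n => v 0 j) @` S.
pose Q := (fun v => push j (fun=> - d) v 0 j) @` S.
have closed_image (g : 'rV[R]_n -> R) : closed (g @` S).
  apply: (accessible_finite_set_closed.1 (hausdorff_accessible (@Rhausdorff R))).
  exact: finite_image.
have PQ0 : P `&` Q = set0.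
  apply/seteqP; split=> // y [[w Sw <-] [v Sv /eqP]].
  by rewrite (negPf (dS v Sv w Sw)).
have [l [cl l0 l1 l01]] := urysohn_ext_itv (@pseudometric_normal R R)
  (closed_image _) (closed_image _) PQ0 (@ltr01 R).
pose c (v : 'rV[R]_n) := l (v 0 j) / 2.
have c_cont : continuous c.
  move=> v; apply: (@cvgM _ _ (nbhs v)); last exact: cvg_cst.
  apply: (@continuous_cvg _ _ _ (nbhs v) _ (fun w : 'rV[R]_n => w 0 j) l).
    exact: cl.
  exact: coord_continuous.
have c_transverse : transverse i c by move=> v w vw; rewrite /c vw 1?eq_sym.
have c1 v : `|c v| < 1.
  have : `[0, 1]%classic (l (v 0 j)) by apply: l01; exists (v 0 j).
  rewrite /= in_itv /= => /andP[l_ge0 l_le1].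
  by rewrite /c ger0_norm; lra.
have [s1 [s1E _]] := extend_push_homeo hX C c_cont c_transverse c1.
exists s1, (homeo_mul (homeo_inv s1) h), tau; split.
- by apply: EV => x; rewrite tauE.
- move=> x Fx; rewrite s1E.
  have [Ux|Ux] := pselect (U x); last exact: extend_out.
  rewrite -(chart_phiK C Ux) (extend_psi C).
  have [vC|vC] := pselect (cube (phi x)); last by rewrite push_out.
  rewrite push_eq0// /c (_ : l _ = 0) ?mul0r//.
  apply: l0; exists (phi x 0 j) => //; exists (phi x) => //.
  by split=> //; exists x.
- move=> x Fx; rewrite tauVE.
  (* h and s1 have the same strength at phi q, or both fix q *)
  suff e q : q = extend U psi phi (push j (fun=> - d)) x -> h q = s1 q.
    by rewrite /= e// (homeo_invP s1).1.
  rewrite hE s1E.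
  have [Ux|Ux] := pselect (U x); last first.
    by rewrite extend_out// => ->; rewrite !extend_out.
  rewrite -(chart_phiK C Ux) (extend_psi C) => ->; rewrite !(extend_psi C).
  have [vC|vC] := pselect (cube (phi x)); last by rewrite !push_out// push_out.
  rewrite /push /c (_ : l _ = 1) ?mul1r//.
  apply: l1; exists (push j (fun=> - d) (phi x) 0 j) => //.
  by exists (phi x) => //; split=> //; exists x.
- by apply: homeo_eq => x /=; rewrite (homeo_invP s1).2.
Unshelve. all: by end_near. Qed.

End Factorization.

Theorem corollary3 (R : realType) (X : metricType R) :
  compact [set: X] ->
  (exists (n : nat) (U : set X), (2 <= n)%N /\ open_cell R n U) ->
  ~ exists t : topology (homeo X), minimum_hausdorff_group_topology t.
Proof.
move=> cX [n [U [n2 cellU]]] [t [[ht gt] tmin]].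
have hX : hausdorff_space X by exact: metric_hausdorff.
have [psi [phi C]] := open_cell_chart cellU.
have [h h1 factor] := push_factorization hX C
  (i := Ordinal (ltnW n2)) (j := Ordinal n2) isT.
have [A [oA /set_mem A1 /set_mem Ah]] : exists A : set (topologized t),
    [/\ open A, (1%g : topologized t) \in A & (h : topologized t) \in ~` A].
  by apply: hausdorff_accessible => //; apply/eqP => /esym.
have [W oW [W1 WA]] := group_topology_mul4 gt oA A1.
have /(nbhs1_filter_topology (idN := uniform_identity_filter cX)) uW :
    nbhs (1%g : topologized (filter_topology (uniform_identity_filter cX))) W.
  by exists W; split=> //; exact/tmin/oW/uniform_hausdorff_topology.
have /(nbhs1_filter_topology (idN := pointwise_identity_filter X)) [F fF FW] :
    nbhs (1%g : topologized (filter_topology (pointwise_identity_filter X))) W.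
  by exists W; split=> //; exact/tmin/oW/pointwise_hausdorff_topology.
have uWV := identity_filterV (uniform_identity_filter cX) uW.
have uFilter := identity_filter_filter (uniform_identity_filter cX).
have [s1 [s2 [tau [[Wtau WtauV] s1F s2F hE]]]] :=
  factor F _ fF (filterI uW uWV).
apply: Ah; suff <- : (s1 * tau^-1 * ((tau * s2 * tau^-1) * tau))%g = h.
  apply: WA => //; apply: FW => //.
  by move=> x Fx /=; rewrite s2F// (homeo_invP tau).2.
by rewrite !mulgA !mulgVK hE.
Qed.
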